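(* There exists a $v$-matrix $\mathcal{H} = \{\mathcal{P}_\alpha : \alpha < \kappa(v)\}$ which is well ordered by the inverse of $\prec$ (that is, $\alpha < \beta$ implies $\mathcal{P}_\beta \prec \mathcal{P}_\alpha$). Moreover, for each $*$-segment $\langle A,B\rangle^*$ there is $\langle C,D\rangle^* \in \bigcup\mathcal{H} = \bigcup_{\alpha<\kappa(v)} \mathcal{P}_\alpha$ such that $\langle C,D\rangle^* \subseteq \langle A,B\rangle^*$.
   Context: $[\omega]^\omega$ is the family of all infinite subsets of $\omega$; $A \subseteq^* X$ means $A\setminus X$ is finite. For $A \subseteq B \subseteq \omega$ with $B\setminus A$ infinite, the set $\langle A,B\rangle^* = \{X \in [\omega]^\omega: A \subseteq^* X \subseteq^* B\}$ is called a $*$-segment. Two $*$-segments are $*$-disjoint if their intersection is countable. A $v$-partition is a family $\mathcal{P}$ of $*$-segments, any two distinct members of which are $*$-disjoint, and which is maximal (with respect to inclusion) among such families. A $v$-matrix is a collection of $v$-partitions. A $v$-partition $\mathcal{P}$ refines a $v$-partition $\mathcal{Q}$, written $\mathcal{P}\prec\mathcal{Q}$, if for each $\langle A,B\rangle^*\in\mathcal{P}$ there exists $\langle C,D\rangle^*\in\mathcal{Q}$ with $\langle A,B\rangle^*\subseteq\langle C,D\rangle^*$. A $v$-matrix $\mathcal{H}$ is shattering if for each $*$-segment $\langle A,B\rangle^*$ there exist $\mathcal{P}\in\mathcal{H}$ and $\langle A_1,B_1\rangle^*, \langle A_2,B_2\rangle^* \in \mathcal{P}$ such that $\langle A_1,B_1\rangle^*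 \cap \langle A,B\rangle^*$ and $\langle A_2,B_2\rangle^* \cap \langle A,B\rangle^*$ are different $*$-segments. $\kappa(v)$ denotes the least cardinality of a shattering $v$-matrix. *)

(* Defs.v *)
From mathcomp Require Import all_boot.
From mathcomp Require Import boolp classical_sets functions cardinality.
From mathcomp Require wochoice.

Set Implicit Arguments.
Unset Strict Implicit.
Unset Printing Implicit Defensive.

Local Open Scope classical_set_scope.
Local Open Scope card_scope.

Definition almost_subset (A B : set nat) : Prop := finite_set (A `\` B).

Definition star_interval (A B : set nat) : set (set nat) :=
  [set X | infinite_set X /\ almost_subset A X /\ almost_subset X B].

(* Segments are compared as sets: the endpoints A and B of a given segment are
   determined only up to finite modifications. *)
Definition star_segment (S : set (set nat)) : Prop :=
  exists A B : set nat,
    A `<=` B /\ infinite_set (B `\` A) /\ S = star_interval A B.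

Definition star_disjoint (S T : set (set nat)) : Prop := countable (S `&` T).

Definition star_disjoint_family (P : set (set (set nat))) : Prop :=
  P `<=` star_segment /\
  forall S T, P S -> P T -> S <> T -> star_disjoint S T.

Definition v_partition (P : set (set (set nat))) : Prop :=
  star_disjoint_family P /\
  forall Q, star_disjoint_family Q -> P `<=` Q -> Q = P.

Definition v_matrix (H : set (set (set (set nat)))) : Prop :=
  H `<=` v_partition.

Definition refines (P Q : set (set (set nat))) : Prop :=
  forall S, P S -> exists T, Q T /\ S `<=` T.

Definition shattering (H : set (set (set (set nat)))) : Prop :=
  forall S, star_segment S ->
  exists P, H P /\
  exists S1 S2, P S1 /\ P S2 /\
    star_segment (S1 `&` S) /\ star_segment (S2 `&` S) /\
    S1 `&` S <> S2 `&` S.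

Definition has_card_kappa_v (K : Type) : Prop :=
  (exists H, v_matrix H /\ shattering H /\ [set: K] #= H) /\
  (forall H, v_matrix H -> shattering H -> [set: K] #<= H).

Definition strict (K : Type) (le : rel K) (x y : K) : Prop :=
  le x y /\ x <> y.

(* There is no type of ordinals: the cardinal kappa(v), seen as the set of all
   alpha < kappa(v), is given up to isomorphism as a well-ordered type of
   cardinality kappa(v) whose proper initial segments all have strictly
   smaller cardinality (i.e. whose order type is an initial ordinal). *)
Definition is_kappa_v (K : Type) (le : rel K) : Prop :=
  wochoice.well_order le /\
  (forall x : K, ~ ([set: K] #<= [set y | strict le y x])) /\
  has_card_kappa_v K.

(* Main.v *)
Require Import Defs.
From mathcomp Require Import all_boot.
From mathcomp Require Import boolp classical_sets functions cardinality.
From mathcomp Require wochoice.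

(* This is the base tree argument of Balcar, Pelant and Simon for the order of
   segments under inclusion. That order is separative, sigma-closed and
   homogeneous, so fewer than kappa(v) v-partitions have a common refinement,
   and a shattering v-matrix of size kappa(v) can be replaced by a refining one
   along kappa(v). By sigma-closedness every segment S meets continuum many
   members of some level: split S along a binary tree and take lower bounds of
   its branches. There are only continuum many segments, so at each level one can
   choose distinct members T(S) for all segments S meeting continuum many of
   them, and refine the level so that the intersection of T(S)
   and S contains one of its members. *)

Set Implicit Arguments.
Unset Strict Implicit.
Unset Printing Implicit Defensive.

Local Open Scope classical_set_scope.

(** * Comparison of cardinals *)

Lemma card_le_fun (T U : Type) (A : set T) (B : set U) (f : T -> U) :
  (forall x, A x -> B (f x)) ->
  (forall x y, A x -> A y -> f x = f y -> x = y) ->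
  (A #<= B)%card.
Proof.
move=> fAB fI.
have [g] : $|{injfun A >-> B}|; last exact: inj_card_le g.
apply/injfunPex; exists f => // x y /set_mem Ax /set_mem Ay; exact: fI.
Qed.

Lemma card_leT_inj (T U : Type) (B : set U) : ([set: T] #<= B)%card ->
  exists f : T -> U, (forall x, B (f x)) /\ injective f.
Proof.
move=> /card_leP[f]; exists (fun x => set_val (f (to_setT x))).
split=> [x|x y /val_inj fxy]; first exact: set_valP.
have : to_setT x = to_setT y by apply: (@inj _ _ _ f); rewrite ?inE.
by move=> /(congr1 val).
Qed.

(* A maximal set [X] of choice functions on which all projections are injective
   must project onto some member of [F]. *)
Lemma exists_least_card (U : Type) (F : set (set U)) : F !=set0 ->
  exists H, F H /\ forall H', F H' -> (H #<= H')%card.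
Proof.
move=> [H0 FH0].
pose good (X : set (set U -> U)) :=
  (forall x, X x -> forall H, F H -> H (x H)) /\
  (forall x y, X x -> X y -> forall H, F H -> x H = y H -> x = y).
have [C Cgood Ctot|X [[XF XI] Xmax]] := @Zorn_bigcup _ good.
  split=> [x [A CA Ax]|x y [A CA Ax] [B CB By]]; first exact: (Cgood A CA).1.
  have [AB|BA] := Ctot A B CA CB.
    by apply: (Cgood B CB).2 => //; exact: AB.
  by apply: (Cgood A CA).2 => //; exact: BA.
(* If [X] projects onto some [H], reading the functions of [X] at [H'] instead of [H] injects [H]
   into [H']. Otherwise a function [z] choosing a missed point of each member of [F] could be added
   to [X]. *)
have [[H [FH XH]]|noH] :=
    pselect (exists H, F H /\ forall u, H u -> exists2 x, X x & x H = u).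
  exists H; split=> // H' FH'.
  have [u|f fP] := @choice U U
    (fun u v => H u -> exists x, [/\ X x, x H = u & v = x H']).
    have [Hu|nHu] := pselect (H u); last by exists u.
    by have [x Xx xu] := XH u Hu; exists (x H') => _; exists x.
  apply: (@card_le_fun _ _ _ _ f) => [u Hu|u v Hu Hv].
    by have [x [Xx _ ->]] := fP u Hu; exact: XF Xx _ FH'.
  have [x [Xx <- ->]] := fP u Hu; have [y [Xy <- ->]] := fP v Hv.
  by move=> /(XI _ _ Xx Xy _ FH') ->.
have new H : F H -> exists2 u, H u & forall x, X x -> x H <> u.
  move=> FH; apply: contrapT => no; apply: noH; exists H; split=> // u Hu.
  by apply: contrapT => nx; apply: no; exists u => // x Xx xu; apply: nx; exists x.
have [u0 _ _] := new H0 FH0.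
have [H|z zP] := @choice (set U) U
    (fun H u => F H -> H u /\ forall x, X x -> x H <> u).
  have [FH|nFH] := pselect (F H); last by exists u0.
  by have [u] := new H FH; exists u.
have nXz : ~ X z by move=> /(zP H0 FH0).2.
case: (Xmax (X `|` [set z])).
  by split=> [x ?|sub]; [left|apply: nXz; apply: sub; right].
split=> [x [Xx|->] H FH|]; [exact: XF Xx _ FH|exact: (zP H FH).1|].
move=> x y [Xx|->] [Xy|->] H FH // e.
- exact: (XI _ _ Xx Xy H).
- by case: ((zP H FH).2 _ Xx).
- by case: ((zP H FH).2 _ Xy).
Qed.

(** * Well-orders and transfinite recursion *)

Section WellOrder.
Context {T : Type} {le : rel T} (wo : wochoice.well_order le).

Lemma wo_least (P : T -> Prop) : (exists x, P x) ->
  exists x, P x /\ forall y, P y -> le x y.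
Proof.
move=> [x Px]; have [|z [[zP zmin] _]] := @wo (fun y => `[< P y >]).
  by exists x; apply/asboolP.
exists z; split; first exact/asboolP.
by move=> y Py; apply: zmin; apply/asboolP.
Qed.

Lemma wo_total x y : le x y \/ le y x.
Proof.
have [|z [zE zmin]] := @wo_least (fun z => z = x \/ z = y); first by exists x; left.
by case: zE => <-; [left|right]; apply: zmin; [right|left].
Qed.

(** Both points are minima of the pair, and [well_order] makes minima unique. *)
Lemma wo_antisym x y : le x y -> le y x -> x = y.
Proof.
have lexx z : le z z by have [] := wo_total z z.
move=> xy yx; have [|z [_ zuniq]] := @wo (fun z => `[< z = x \/ z = y >]).
  by exists x; apply/asboolP; left.
have min w : w = x \/ w = y ->
    wochoice.minimum_of le (fun z => `[< z = x \/ z = y >]) w.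
  move=> wE; split; first exact/asboolP.
  by move=> v /asboolP[] ->; case: wE => ->.
by rewrite -(zuniq x (min x _)) 1?(zuniq y (min y _)) //; [right|left].
Qed.

Lemma wo_strict_total x y : ~ strict le x y -> y = x \/ strict le y x.
Proof.
move=> nxy; have [->|ne] := pselect (y = x); [by left|right].
split=> //; have [xy|//] := wo_total x y.
by case: nxy; split=> // e; apply: ne.
Qed.

Lemma wo_strict_wf : well_founded (strict le).
Proof.
move=> x; apply: contrapT => nx.
have [|z [nz zmin]] := @wo_least (fun y => ~ Acc (strict le) y); first by exists x.
apply: nz; constructor=> y [yz ne]; apply: contrapT => ny.
by apply: ne; apply: wo_antisym => //; exact: zmin.
Qed.

End WellOrder.

(** If a well-order [R] has proper initial segments of full size, take the least [x] bounding one
    and pull [R] back along an injection [f] of [T] into it. A full-size segment below [t] in the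
    new order would give one below [f t] in [R], although [f t] precedes [x]. *)
Lemma exists_initial_well_order (T : Type) : exists le : rel T,
  wochoice.well_order le /\
  forall x : T, ~ ([set: T] #<= [set y | strict le y x])%card.
Proof.
elim/Peq: T => T.
have [R wo] := wochoice.well_ordering_principle T.
have [[x xP]|no] :=
    pselect (exists x, [set: T] #<= [set y | strict R y x])%card; last first.
  by exists R; split=> // x ?; apply: no; exists x.
have [|{xP}x [xP xmin]] :=
  @wo_least _ _ wo (fun x => is_true ([set: T] #<= [set y | strict R y x])%card).
  by exists x.
have [f [fx fI]] := @card_leT_inj _ _ _ xP.
exists (fun a b => R (f a) (f b)); split.
  apply: wochoice.antisymmetric_well_order.
    by move=> a b /andP[ab ba]; apply: fI; exact: wo_antisym ab ba.
  move=> A [a Aa].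
  have [|z [[b [Ab ->]] zmin]] := @wo_least _ _ wo
    (fun z => exists b, b \in A /\ z = f b); first by exists (f a), a.
  by exists b; split=> // c Ac; apply: zmin; exists c.
move=> t /card_leT_inj[g [gt gI]]; have [fxt ne] := fx t; apply: ne.
apply: (wo_antisym wo fxt); apply: xmin.
apply: (@card_le_fun _ _ _ _ (f \o g)) => [a _|a b _ _ /fI/gI //].
by have [le1 ne] := gt a; split=> //= /fI.
Qed.

(** Recursion with a choice at each stage. The second hypothesis says that stage [a] looks at [g]
    only below [a], so the values already built may be completed by the default [t0]. *)
Lemma wf_choice (K T : Type) (lt : K -> K -> Prop) (Q : K -> (K -> T) -> T -> Prop)
    (t0 : T) :
  well_founded lt ->
  (forall a g g' t, (forall b, lt b a -> g b = g' b) -> Q a g t -> Q a g' t) ->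
  (forall a g, (forall b, lt b a -> Q b g (g b)) -> exists t, Q a g t) ->
  exists g, forall a, Q a g (g a).
Proof.
move=> wf Qext Qex.
pose ext a (f : forall b, lt b a -> T) b :=
  if pselect (lt b a) is left h then f b h else t0.
pose F a f :=
  if pselect (exists t, Q a (ext a f) t) is left h then sval (cid h) else t0.
pose g := Fix wf (fun=> T) F.
have extE a f f' : (forall b h, f b h = f' b h) -> ext a f = ext a f'.
  by move=> ff'; apply: funext => b; rewrite /ext; case: pselect.
have gE a : g a = F a (fun b _ => g b).
  by rewrite /g Fix_eq// => x f f' /extE; rewrite /F => ->.
exists g; elim/(well_founded_ind wf) => a IH.
have extg b : lt b a -> ext a (fun b _ => g b) b = g b.
  by rewrite /ext; case: pselect.
rewrite gE /F; case: pselect => [h|[]].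
  by apply: Qext (svalP (cid h)) => b /extg.
by have [t Qt] := Qex a g IH; exists t; apply: Qext Qt => b /extg.
Qed.

(* By Glivenko's theorem, [tauto] proves the double negation of every classical
   propositional tautology. *)
Ltac set_tauto :=
  intros; cbv beta delta [setD setU setI setC mkset] in *;
  apply: contrapT; tauto.

(** * Sets modulo finite sets *)

Lemma finite_sub2 (T : Type) (X Y Z : set T) : finite_set Y -> finite_set Z ->
  (forall x, X x -> Y x \/ Z x) -> finite_set X.
Proof.
by move=> Yfin Zfin XYZ; apply: (@sub_finite_set _ _ (Y `|` Z)); rewrite ?finite_setU.
Qed.

Lemma almost_subsetW (A B : set nat) : A `<=` B -> almost_subset A B.
Proof. by move=> AB; rewrite /almost_subset setDE (disjoints_subset _ _).2 // setCK. Qed.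

Lemma almost_subset_trans (B A C : set nat) :
  almost_subset A B -> almost_subset B C -> almost_subset A C.
Proof. by move=> AB BC; apply: (finite_sub2 AB BC) => x; set_tauto. Qed.

Lemma almost_subset_bigcap (A : set nat) (B : nat -> set nat) n :
  (forall k, k <= n -> almost_subset A (B k)) ->
  almost_subset A [set x | forall k, k <= n -> B k x].
Proof.
elim: n => [|n IH] AB.
  by apply: sub_finite_set (AB 0 _) => // x [Ax nBx]; split=> // Bx;
    apply: nBx => k; rewrite leqn0 => /eqP ->.
have IH' := IH (fun k kn => AB k (leqW kn)).
apply: (finite_sub2 IH' (AB n.+1 (leqnn _))) => x [Ax nBx].
have [Bx|] := pselect (B n.+1 x); [left|by right].
split=> // allB; apply: nBx => k; rewrite leq_eqVlt => /orP[/eqP -> //|].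
exact: allB.
Qed.

(** Along an injection of [nat] into [E], odd indices go into [F] and even ones stay outside. *)
Lemma infinite_split (T : Type) (E : set T) : infinite_set E ->
  exists F, [/\ F `<=` E, infinite_set F & infinite_set (E `\` F)].
Proof.
move=> /infiniteP/card_leT_inj[f [fE fI]].
exists (f @` [set n | odd n]); split.
- by move=> _ [n _ <-].
- apply/infiniteP/(@card_le_fun _ _ _ _ (fun n => f n.*2.+1)) => [n _|m n _ _ /fI].
    by exists n.*2.+1 => //=; rewrite odd_double.
  by case=> /double_inj.
- apply/infiniteP/(@card_le_fun _ _ _ _ (fun n => f n.*2)) => [n _|m n _ _ /fI].
    by split=> // -[m /= m_odd /fI mn]; rewrite mn odd_double in m_odd.
  exact: double_inj.
Qed.

Lemma infinite_of_unbounded (E : set nat) :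
  (forall n, exists2 m, E m & n <= m) -> infinite_set E.
Proof.
move=> unb /finite_seqP[s sE]; have [m] := unb (\max_(i <- s) i).+1.
rewrite sE /= => ms; apply/negP; rewrite -leqNgt.
by rewrite (big_rem _ ms) /= leq_maxl.
Qed.

(** * The order of segments under inclusion *)

Lemma star_intervalS (A B C D : set nat) :
  almost_subset C A -> almost_subset B D ->
  star_interval A B `<=` star_interval C D.
Proof.
move=> CA BD X [Xinf [AX XB]]; split=> //; split.
  exact: almost_subset_trans AX.
exact: almost_subset_trans BD.
Qed.

Lemma eq_star_interval (A B C D : set nat) :
  almost_subset A C -> almost_subset C A ->
  almost_subset B D -> almost_subset D B ->
  star_interval A B = star_interval C D.
Proof. by move=> AC CA BD DB; apply/seteqP; split; apply: star_intervalS. Qed.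

Lemma star_segment_interval (A B : set nat) :
  almost_subset A B -> infinite_set (B `\` A) -> star_segment (star_interval A B).
Proof.
move=> AB BAinf; exists (A `&` B), B; split; first by move=> x [].
split; first by apply: sub_infinite_set BAinf => x; set_tauto.
apply: eq_star_interval; try exact: almost_subsetW.
by apply: sub_finite_set AB => x; set_tauto.
Qed.

(** The member [B] of the first interval gives the bound by [D]. If [C] minus [A] were infinite,
    adding only half [F] of it to [A] would give a member of the first interval that does not almost
    contain [C]. *)
Lemma star_interval_sub (A B C D : set nat) :
  almost_subset A B -> infinite_set (B `\` A) ->
  star_interval A B `<=` star_interval C D ->
  almost_subset C A /\ almost_subset B D.
Proof.
move=> AB BAinf sub; have Binf : infinite_set B.
  by apply: sub_infinite_set BAinf => x [].
have [_ [CB BD]] : star_interval C D B.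
  by apply: sub; split=> //; split=> //; exact: almost_subsetW.
split=> //; apply: contrapT => /infinite_split[F [FCA Finf]]; apply.
have [_ [CX _]] : star_interval C D (A `|` F).
  apply: sub; split; first by apply: sub_infinite_set Finf => x; right.
  split; first by apply: almost_subsetW => x; left.
  by apply: (finite_sub2 AB CB) => x; have := FCA x; set_tauto.
by apply: sub_finite_set CX => x; set_tauto.
Qed.

Lemma star_intervalI (A B C D : set nat) :
  star_interval A B `&` star_interval C D = star_interval (A `|` C) (B `&` D).
Proof.
apply/seteqP; split=> [X [[Xinf [AX XB]] [_ [CX XD]]]|X [Xinf [ACX XBD]]].
  split=> //; split; first by apply: (finite_sub2 AX CX) => x; set_tauto.
  by apply: (finite_sub2 XB XD) => x; set_tauto.
split; split=> //; split; first [apply: sub_finite_set ACX => x; set_tauto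
  | apply: sub_finite_set XBD => x; set_tauto].
Qed.

(** Symmetric difference with [A] injects these sets into the finite subsets of [nat]. *)
Lemma countable_almost_eq (A : set nat) :
  countable [set X | almost_subset A X /\ almost_subset X A].
Proof.
pose sd (X : set nat) := (A `\` X) `|` (X `\` A).
apply: sub_countable (@countable_finite_subset nat setT (countableP _)).
apply: (@card_le_fun _ _ _ _ sd) => [X [AX XA]|X Y _ _ sdXY].
  by split=> //; rewrite finite_setU.
apply/seteqP; split=> x; have : sd X x <-> sd Y x by rewrite sdXY.
  by rewrite /sd; set_tauto.
by rewrite /sd; set_tauto.
Qed.

(** The intersection is again an interval. It is empty if its endpoints are not almost included in
    each other, and it consists of sets almost equal to one set if they differ finitely. Otherwise
    it is a segment, so two segments are disjoint or have a common lower bound. *)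
Lemma star_segmentI (S T : set (set nat)) : star_segment S -> star_segment T ->
  star_disjoint S T \/ star_segment (S `&` T).
Proof.
move=> [A [B [AB [_ ->]]]] [C [D [CD [_ ->]]]].
rewrite /star_disjoint star_intervalI.
have [sub|nsub] := pselect (almost_subset (A `|` C) (B `&` D)); last first.
  left; rewrite (_ : star_interval _ _ = set0) //.
  apply/seteqP; split=> // X [_ [ACX XBD]]; apply: nsub.
  exact: almost_subset_trans XBD.
have [fin|inf] := pselect (finite_set ((B `&` D) `\` (A `|` C))); last first.
  by right; exact: star_segment_interval.
left; apply: sub_countable (countable_almost_eq (A `|` C)).
apply: subset_card_le => X [_ [ACX XBD]]; split=> //.
exact: almost_subset_trans fin.
Qed.

(** With half [F] of [B] minus [A] left free and the rest of [B] kept, all subsets of [nat] are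
    coded inside the segment; Cantor's diagonal argument concludes. *)
Lemma uncountable_star_segment (S : set (set nat)) :
  star_segment S -> ~ countable S.
Proof.
move=> [A [B [AB [inf ->]]]] cnt.
have [F [FBA Finf Ginf]] := infinite_split inf.
have [g [gF gI]] := card_leT_inj ((infiniteP _).1 Finf).
pose h (X : set nat) := (B `\` F) `|` (g @` X).
have hI : injective h.
  suff sub X Y : h X = h Y -> X `<=` Y.
    by move=> X Y hXY; apply/seteqP; split; apply: sub.
  move=> hXY x Xx; have : h Y (g x) by rewrite -hXY; right; exists x.
  by case=> [[_]|[y Yy /gI <- //]]; have := gF x.
have : countable [set: set nat].
  apply: sub_countable cnt; apply: (@card_le_fun _ _ _ _ h) => [X _|X Y _ _ /hI //].
  split; first by apply: sub_infinite_set Ginf => x [[Bx _] nFx]; left.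
  split; apply: almost_subsetW => x.
    by move=> Ax; left; split; [exact: AB|move=> /FBA[]].
  by case=> [[]//|[y _ <-]]; have [] := FBA _ (gF y).
move=> /card_leT_inj[k [_ kI]].
pose diag := [set n | forall X, k X = n -> ~ X n].
have : ~ diag (k diag) by move=> /[dup] dd; exact.
by apply=> X /kI ->; move=> /[dup] dd; exact.
Qed.

(** The infinite set [E] is almost contained in every member of one interval and almost avoided by
    every member of the other. *)
Lemma star_disjoint_intervals (A B C D E : set nat) : infinite_set E ->
  (E `<=` A /\ E `&` D `<=` set0 \/ E `<=` C /\ E `&` B `<=` set0) ->
  star_disjoint (star_interval A B) (star_interval C D).
Proof.
move=> Einf; rewrite /star_disjoint => EAD.
rewrite (_ : _ `&` _ = set0) //; apply/seteqP; split=> // X.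
move=> [[_ [AX XB]] [_ [CX XD]]]; apply: Einf.
case: EAD => -[EA ED]; [apply: (finite_sub2 AX XD)|apply: (finite_sub2 CX XB)];
  by move=> x; have := EA x; have := ED x; rewrite /set0; set_tauto.
Qed.

(** When the two segments meet, an endpoint of [S] violates the bounds of [T] on an infinite set.
    Moving that endpoint by half [E] of this set makes it disjoint from [T], and the other half
    keeps the gap between the endpoints infinite. *)
Lemma star_segment_separative (S T : set (set nat)) :
  star_segment S -> star_segment T -> ~ S `<=` T ->
  exists S', [/\ star_segment S', S' `<=` S & star_disjoint S' T].
Proof.
move=> Sseg Tseg nST; have [dis|ST] := star_segmentI Sseg Tseg; first by exists S; split.
have := uncountable_star_segment ST.
move: Sseg Tseg nST {ST} => [A [B [AB [BA ->]]]] [C [D [CD [DC ->]]]] nST unc.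
have [[X [[_ [AX XB]] [_ [CX XD]]]]|empty] := pselect (exists X,
    (star_interval A B `&` star_interval C D) X); last first.
  by case: unc; rewrite (_ : _ `&` _ = set0) //; apply/seteqP; split=> // X SX;
    case: empty; exists X.
have CB := almost_subset_trans CX XB; have AD := almost_subset_trans AX XD.
have [CA|/infinite_split[E [ECA Einf Finf]]] := pselect (almost_subset C A).
  have [BD|/infinite_split[E [EBD Einf Finf]]] := pselect (almost_subset B D).
    by case: nST; exact: star_intervalS.
  exists (star_interval (A `|` E) B); split.
  - apply: star_segment_interval; first by apply: almost_subsetW => x;
      have := EBD x; have := AB x; set_tauto.
    move=> fin; apply: Finf.
    by apply: (finite_sub2 fin AD) => x; have := EBD x; set_tauto.
  - apply: star_intervalS; last exact: almost_subsetW.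
    by apply: almost_subsetW => x; left.
  - apply: (star_disjoint_intervals Einf); left; split=> x; first by right.
    by have := EBD x; rewrite /set0; set_tauto.
exists (star_interval A (B `\` E)); split.
- apply: star_segment_interval; first by apply: almost_subsetW => x;
    have := ECA x; have := AB x; set_tauto.
  move=> fin; apply: Finf.
  by apply: (finite_sub2 fin CB) => x; have := ECA x; set_tauto.
- by apply: star_intervalS; apply: almost_subsetW => // x [].
- apply: (star_disjoint_intervals Einf); right; split=> x.
    by have := ECA x; set_tauto.
  by rewrite /set0; set_tauto.
Qed.

(** Raising the lower endpoint by half of the gap gives a proper subsegment, and separativity gives
    a segment disjoint from it. *)
Lemma star_segment_split (S : set (set nat)) : star_segment S ->
  exists S1 S2, [/\ star_segment S1, star_segment S2, S1 `<=` S, S2 `<=` S &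
    star_disjoint S1 S2].
Proof.
move=> Sseg; have [A [B [AB [BA SE]]]] := Sseg.
have [E [EBA Einf Finf]] := infinite_split BA.
pose T := star_interval (A `|` E) B.
have TS : T `<=` S.
  by rewrite SE; apply: star_intervalS; apply: almost_subsetW => // x; left.
have Tseg : star_segment T.
  apply: star_segment_interval; first by apply: almost_subsetW => x;
    have := AB x; have := EBA x; set_tauto.
  by apply: sub_infinite_set Finf => x; set_tauto.
have [|S' [S'seg S'S dis]] := star_segment_separative Sseg Tseg; last first.
  by exists S', T.
rewrite SE => /star_interval_sub[]//; first exact: almost_subsetW.
move=> AEA _; apply: Einf; apply: sub_finite_set AEA => x.
by have := EBA x; set_tauto.
Qed.

(* [E] picks one element of each set of a decreasing sequence [G], and [M] lies
   between all the [A n] and all the [B n] modulo finite sets; the lower bound is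
   the interval from [M] minus [E] to [M] plus [E]. *)
Lemma star_segment_sigma_closed (S : nat -> set (set nat)) :
  (forall n, star_segment (S n)) -> (forall n, S n.+1 `<=` S n) ->
  exists2 T, star_segment T & forall n, T `<=` S n.
Proof.
move=> Sseg Sdec.
have [A AP] := choice Sseg; have [B BP] := choice AP.
have Anon m n : m <= n -> almost_subset (A m) (A n) /\ almost_subset (B n) (B m).
  move=> /subnK <-; elim: (n - m) => [|k [IHA IHB]].
    by split; exact: almost_subsetW.
  have [AB [BA SE]] := BP (k.+1 + m); have [_ [_ SE']] := BP (k + m).
  have /star_interval_sub[||AA BB] // : star_interval (A (k.+1 + m)) (B (k.+1 + m))
      `<=` star_interval (A (k + m)) (B (k + m)).
  - by rewrite -SE -SE'; exact: Sdec.
  - exact: almost_subsetW.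
  split; first exact: almost_subset_trans AA.
  exact: almost_subset_trans IHB.
have AB m n : almost_subset (A m) (B n).
  have [Am _] := Anon _ _ (leq_maxl m n); have [_ Bn] := Anon _ _ (leq_maxr m n).
  apply: almost_subset_trans Am (almost_subset_trans _ Bn).
  by apply: almost_subsetW; have [] := BP (maxn m n).
pose G n := [set x | forall k, k <= n -> (B k `\` A k) x].
have Ginf n : infinite_set (G n).
  have [_ [BA _]] := BP n; move=> Gfin; apply: BA.
  have : almost_subset (B n `\` A n) (G n).
    apply: almost_subset_bigcap => k kn; have [Ak Bk] := Anon _ _ kn.
    by apply: (finite_sub2 Ak Bk) => x; set_tauto.
  by move=> sub; apply: (finite_sub2 sub Gfin) => x; set_tauto.
(* Choosing [e n] at least [n] makes the range of [e] infinite. *)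
have [n|e eP] := @choice nat nat (fun n m => G n m /\ n <= m).
  apply: contrapT => no; apply: (Ginf n).
  apply: sub_finite_set (finite_II n) => x Gx /=.
  by rewrite ltnNge; apply/negP => nx; apply: no; exists x.
pose E := range e.
have Einf : infinite_set E.
  by apply: infinite_of_unbounded => n; exists (e n); [exists n|have [] := eP n].
have EG n : almost_subset E (G n).
  apply: (@sub_finite_set _ _ (e @` `I_n)); last exact/finite_image/finite_II.
  move=> _ [[m _ <-] nGm]; exists m => //=; rewrite ltnNge; apply/negP => nm.
  by apply: nGm => k kn; apply: (eP m).1; exact: leq_trans nm.
have EA n : finite_set (E `&` A n).
  apply: sub_finite_set (EG n) => x [Ex Ax]; split=> // Gx.
  by have [] := Gx n (leqnn n).
have EB n : almost_subset E (B n).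
  apply: almost_subset_trans (EG n) _; apply: almost_subsetW => x Gx.
  by have [] := Gx n (leqnn n).
(* A point of [A n] enters [M] through [n] only if it lies in every [B k] with [k <= n]. Hence what
   [M] has outside [B n] comes from the finitely many [A k] with [k < n]. *)
pose M := [set x | exists n, A n x /\ forall k, k <= n -> B k x].
have AM n : almost_subset (A n) M.
  have := @almost_subset_bigcap (A n) B n (fun k _ => AB n k).
  by apply: sub_finite_set => x [Ax nMx]; split=> // allB; apply: nMx; exists n.
have MB n : almost_subset M (B n).
  (* The induction runs on the bound [m] of the indices while [B n] stays fixed. *)
  have [m mP] : {m | m = n} by exists n.
  apply: (@sub_finite_set _ _ [set x | exists2 k, k < n & (A k `\` B n) x]).
    move=> x [[k [Ax allB]] nBx]; exists k => //.
    by rewrite ltnNge; apply/negP => /allB.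
  rewrite -{1}mP; elim: m {mP} => [|m IH].
    by rewrite (_ : mkset _ = set0) //; apply/seteqP; split=> // x [].
  apply: (finite_sub2 IH (AB m n)) => x [k].
  by rewrite ltnS leq_eqVlt => /orP[/eqP -> ?|km ?]; [right|left; exists k].
exists (star_interval (M `\` E) (M `|` E)).
  apply: star_segment_interval; first by apply: almost_subsetW => x; set_tauto.
  by apply: sub_infinite_set Einf => x; set_tauto.
move=> n; have [_ [_ ->]] := BP n; apply: star_intervalS.
  by apply: (finite_sub2 (AM n) (EA n)) => x; set_tauto.
by apply: (finite_sub2 (MB n) (EB n)) => x; set_tauto.
Qed.

(** Let [g] enumerate [B] minus [A] bijectively. Sending [X] to the union of [A] and its image by
    [g] preserves and reflects almost inclusion, and between [A] and [B] the preimage by [g] inverts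
    it up to finite sets. *)
Lemma star_segment_homogeneous (S : set (set nat)) : star_segment S ->
  exists f : set (set nat) -> set (set nat),
  [/\ forall T, star_segment T -> star_segment (f T) /\ f T `<=` S,
      forall U, star_segment U -> U `<=` S -> exists2 T, star_segment T & f T = U
    & forall T T', star_segment T -> star_segment T' -> (f T `<=` f T' <-> T `<=` T')].
Proof.
move=> [A [B [AB [BA ->]]]].
have [g [gBA gI gS]] : exists g : nat -> nat,
    [/\ forall n, (B `\` A) (g n), injective g &
      forall x, (B `\` A) x -> exists n, g n = x].
  have /card_esym/pcard_eqP/bijPex[g [gBA gI gS]] := eq_card_nat (countableP _) BA.
  exists g; split=> [n|m n gmn|x /gS[n _ <-]]; last by exists n.
    exact: gBA.
  by apply: gI; rewrite ?inE.
pose h X := A `|` (g @` X).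
have hP X Y : almost_subset (h X) (h Y) <-> almost_subset X Y.
  rewrite /almost_subset; have -> : h X `\` h Y = g @` (X `\` Y).
    apply/seteqP; split=> x.
      case=> [[Ax|[y Xy <-]] nhY]; first by case: nhY; left.
      by exists y => //; split=> // Yy; apply: nhY; right; exists y.
    case=> y [Xy nYy] <-; split; first by right; exists y.
    by case=> [|[z Yz /gI zy]]; [have [] := gBA y|apply: nYy; rewrite -zy].
  split; last exact: finite_image.
  apply: card_le_finite; apply: (@card_le_fun _ _ _ _ g) => [x ?|x y _ _ /gI //].
  by exists x.
have hK Y : almost_subset A Y -> almost_subset Y B ->
    almost_subset (h (g @^-1` Y)) Y /\ almost_subset Y (h (g @^-1` Y)).
  move=> AY YB; split; [apply: sub_finite_set AY|apply: sub_finite_set YB] => x.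
    by case=> [[Ax|[y Yy <-]]].
  move=> [Yx nhx]; split=> // Bx; apply: nhx; have [Ax|nAx] := pselect (A x).
    by left.
  by have [n gnx] := gS x (conj Bx nAx); right; exists n; rewrite /= ?gnx.
(* Since [f] must depend on the segment as a set, a pair of endpoints is fixed for each segment;
   other sets get a pair of empty sets. *)
have [T|lo loP] := @choice (set (set nat)) (set nat * set nat) (fun T p =>
  star_segment T -> [/\ p.1 `<=` p.2, infinite_set (p.2 `\` p.1) &
    T = star_interval p.1 p.2]).
  have [[C [D [CD [DC ->]]]]|nT] := pselect (star_segment T).
    by exists (C, D).
  by exists (set0, set0).
pose f T := star_interval (h (lo T).1) (h (lo T).2).
have f_sub T T' : star_segment T -> star_segment T' -> f T `<=` f T' <-> T `<=` T'.
  move=> /loP[CD DC TE] /loP[CD' DC' TE']; rewrite {2}TE {2}TE'; split=> sub.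
    have [||CC DD] := star_interval_sub _ _ sub; first exact/hP/almost_subsetW.
      by move=> /hP.
    by apply: star_intervalS; apply/hP.
  have [||CC DD] := star_interval_sub _ _ sub => //; first exact: almost_subsetW.
  by apply: star_intervalS; apply/hP.
exists f; split=> // [T Tseg|U Useg US].
  have [CD DC TE] := loP T Tseg; split.
    apply: star_segment_interval; first exact/hP/almost_subsetW.
    by move=> /hP.
  apply: star_intervalS; apply: almost_subsetW => x; first by left.
  by case=> [/AB //|[n _ <-]]; have [] := gBA n.
have [C [D [CD [DC UE]]]] := Useg.
have [||AC DB] := @star_interval_sub C D A B _ DC; first exact: almost_subsetW.
  by rewrite -UE.
have AD := almost_subset_trans AC (almost_subsetW CD).
have CB := almost_subset_trans (almost_subsetW CD) DB.
have [hC Ch] := hK C AC CB; have [hD Dh] := hK D AD DB.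
pose T := star_interval (g @^-1` C) (g @^-1` D).
have gCD : almost_subset (g @^-1` C) (g @^-1` D).
  by apply: almost_subsetW => x /CD.
have gDC : infinite_set (g @^-1` D `\` g @^-1` C).
  move=> /hP fin; apply: DC.
  exact: almost_subset_trans Dh (almost_subset_trans fin hC).
have Tseg : star_segment T by exact: star_segment_interval.
exists T => //; have [CD' DC' TE] := loP T Tseg.
have [||/hP loC /hP loD] := @star_interval_sub (lo T).1 (lo T).2
  (g @^-1` C) (g @^-1` D) _ DC'; first exact: almost_subsetW.
  by rewrite -TE.
have [//|//||/hP Clo /hP Dlo] := @star_interval_sub (g @^-1` C) (g @^-1` D)
  (lo T).1 (lo T).2; first by rewrite -TE.
rewrite UE; apply: eq_star_interval.
- exact: almost_subset_trans Clo hC.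
- exact: almost_subset_trans Ch loC.
- exact: almost_subset_trans loD hD.
- exact: almost_subset_trans Dh Dlo.
Qed.

(** * Disjointness and v-partitions *)

Lemma star_disjointC (S T : set (set nat)) : star_disjoint S T -> star_disjoint T S.
Proof. by rewrite /star_disjoint setIC. Qed.

Lemma star_disjointS (S S' T T' : set (set nat)) :
  S' `<=` S -> T' `<=` T -> star_disjoint S T -> star_disjoint S' T'.
Proof.
by move=> SS TT; apply: sub_countable; apply: subset_card_le; exact: setISS.
Qed.

Lemma star_disjoint_segmentF (S T U : set (set nat)) :
  star_segment U -> U `<=` S -> U `<=` T -> ~ star_disjoint S T.
Proof.
move=> Useg US UT dis; apply: (uncountable_star_segment Useg).
by apply: sub_countable dis; apply: subset_card_le => X UX; split; [exact: US|exact: UT].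
Qed.

Lemma not_star_disjoint (S T : set (set nat)) : star_segment S -> star_segment T ->
  ~ star_disjoint S T -> star_segment (S `&` T).
Proof. by move=> /star_segmentI/[apply] -[]. Qed.

Lemma star_disjoint_family_eq (P : set (set (set nat))) (S T U : set (set nat)) :
  star_disjoint_family P -> P S -> P T -> star_segment U ->
  U `<=` S -> U `<=` T -> S = T.
Proof.
move=> [_ dis] PS PT Useg US UT; apply: contrapT => /(dis _ _ PS PT).
exact: star_disjoint_segmentF Useg US UT.
Qed.

(** A segment disjoint from all of [P] would belong to [P] by maximality, hence be disjoint from
    itself, but segments are uncountable. *)
Lemma v_partition_meets (P : set (set (set nat))) (S : set (set nat)) :
  v_partition P -> star_segment S -> exists2 T, P T & star_segment (T `&` S).
Proof.
move=> [[Pseg Pdis] Pmax] Sseg; apply: contrapT => no.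
have dis T : P T -> star_disjoint T S.
  move=> PT; have [//|TS] := star_segmentI (Pseg _ PT) Sseg.
  by case: no; exists T.
have PS : P S.
  rewrite -(Pmax (P `|` [set S])); [by right| |by left].
  split=> [T [/Pseg //|->] //|T U [PT|->] [PU|->] TU].
  - exact: Pdis.
  - exact: dis.
  - exact/star_disjointC/dis.
  - by [].
exact: (@star_disjoint_segmentF S S S _ _ _ (dis S PS)).
Qed.

Lemma v_partition_predense (P : set (set (set nat))) : star_disjoint_family P ->
  (forall S, star_segment S -> exists2 T, P T & ~ star_disjoint T S) ->
  v_partition P.
Proof.
move=> Pdis Pdense; split=> // Q [Qseg Qdis] PQ; apply/seteqP; split=> // S QS.
have [T PT nTS] := Pdense S (Qseg S QS).
have [<- //|ne] := pselect (T = S).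
by case: nTS; apply: Qdis => //; exact: PQ.
Qed.

Lemma exists_v_partition (D A : set (set (set nat))) :
  D `<=` star_segment ->
  (forall S, star_segment S -> exists2 T, D T & T `<=` S) ->
  A `<=` D -> star_disjoint_family A ->
  exists P, [/\ v_partition P, A `<=` P & P `<=` D].
Proof.
move=> Dseg Ddense AD Adis.
(* [A] is joined to [X] from outside, so that the empty chain has an admissible union too. *)
have [C Cgood Ctot|X [[XD Xdis] Xmax]] := @Zorn_bigcup _
    (fun X : set (set (set nat)) => X `<=` D /\ star_disjoint_family (A `|` X)).
  have sub : \bigcup_(X in C) X `<=` D by move=> S [X /Cgood[XD _]] /XD.
  split=> //; split=> [S [/AD|/sub]|S T [AS|[X CX XS]] [AT|[Y CY YT]]]; try exact: Dseg.
  - exact: Adis.2.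
  - by apply: (Cgood Y CY).2.2; [left|right].
  - by apply: (Cgood X CX).2.2; [right|left].
  - have [XY|YX] := Ctot X Y CX CY.
      by apply: (Cgood Y CY).2.2; right => //; exact: XY.
    by apply: (Cgood X CX).2.2; right => //; exact: YX.
have AXD : A `|` X `<=` D by move=> S [/AD|/XD].
exists (A `|` X); split=> //.
apply: v_partition_predense => // S /Ddense[T DT TS].
apply: contrapT => no.
have dis U : (A `|` X) U -> star_disjoint U T.
  move=> AXU; apply: contrapT => UT; apply: no; exists U => //.
  by apply: contra_not UT; exact: star_disjointS.
apply: (Xmax (X `|` [set T])).
  split=> [U ?|sub]; first by left.
  apply: (@star_disjoint_segmentF T T T); rewrite //; first exact: Dseg.
  by apply: dis; right; apply: sub; right.
split=> [U [/XD //|->] //|]; split=> [U|U V]; rewrite setUA.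
  by case=> [/AXD/Dseg|->] //; exact: Dseg.
case=> [AXU|->] [AXV|->] UV //.
- exact: Xdis.2.
- exact: dis.
- exact/star_disjointC/dis.
Qed.

(** * Dense open sets generated by v-partitions, and shattering *)

Definition below (P : set (set (set nat))) (S : set (set nat)) : Prop :=
  exists2 T, P T & S `<=` T.

Lemma belowS (P : set (set (set nat))) (S S' : set (set nat)) :
  S' `<=` S -> below P S -> below P S'.
Proof. by move=> SS [T PT ST]; exists T => // X /SS/ST. Qed.

Lemma below_refines (P Q : set (set (set nat))) (S : set (set nat)) :
  refines P Q -> below P S -> below Q S.
Proof. by move=> PQ [T /PQ[U [QU TU]] ST]; exists U => // X /ST/TU. Qed.

Lemma refines_trans (P Q R : set (set (set nat))) :
  refines P Q -> refines Q R -> refines P R.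
Proof.
by move=> PQ QR S /PQ[T [/QR[U [RU TU]] ST]]; exists U; split=> // X /ST/TU.
Qed.

Lemma below_dense (P : set (set (set nat))) (S : set (set nat)) : v_partition P ->
  star_segment S -> exists T, [/\ star_segment T, T `<=` S & below P T].
Proof.
by move=> Ppart /(v_partition_meets Ppart)[T PT TS]; exists (T `&` S); split=> //;
  exists T.
Qed.

(** One member [T] meets [S]; separativity gives a part of [S] disjoint from [T], and a member
    meeting that part is the second one. *)
Lemma not_below_split (P : set (set (set nat))) (S : set (set nat)) : v_partition P ->
  star_segment S -> ~ below P S ->
  exists T U, [/\ P T, P U, T <> U, star_segment (T `&` S) & star_segment (U `&` S)].
Proof.
move=> Ppart Sseg nbelow; have [[Pseg _] _] := Ppart.
have [T PT TS] := v_partition_meets Ppart Sseg.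
have [|S' [S'seg S'S dis]] := star_segment_separative Sseg (Pseg T PT).
  by move=> ST; apply: nbelow; exists T.
have [U PU US'] := v_partition_meets Ppart S'seg.
exists T, U; split=> //.
  by move=> TU; apply: (star_disjoint_segmentF US' _ _ dis); [|rewrite TU].
apply: not_star_disjoint => //; first exact: Pseg.
by apply: (star_disjoint_segmentF US') => // X [_ /S'S].
Qed.

(** A segment inside a member of [P] meets no other member in a segment, and one inside no member
    meets two by [not_below_split]. So shattering means that the dense open sets have no common
    segment. *)
Lemma shatteringP (H : set (set (set (set nat)))) : v_matrix H ->
  shattering H <-> forall S, star_segment S -> exists2 P, H P & ~ below P S.
Proof.
move=> Hpart; split=> sh S Sseg; have := sh S Sseg.
  move=> [P [HP [S1 [S2 [PS1 [PS2 [S1S [S2S ne]]]]]]]]; exists P => //.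
  have Pdis := (Hpart P HP).1; move=> [T PT ST]; apply: ne.
  have eqT U : P U -> star_segment (U `&` S) -> U = T.
    by move=> PU US; apply: (star_disjoint_family_eq Pdis PU PT US) => // X [_ /ST].
  by rewrite (eqT S1) // (eqT S2).
move=> [P HP /not_below_split-/(_ (Hpart P HP) Sseg)[T [U [PT PU TU TS US]]]].
exists P; split=> //; exists T, U; do 4!split=> //.
move=> e; apply: TU; apply: (star_disjoint_family_eq (Hpart P HP).1 PT PU TS) => //.
by rewrite e.
Qed.

(** This makes kappa(v) well defined: two disjoint segments inside [S] extend to a v-partition, none
    of whose members can contain [S]. *)
Lemma shattering_v_partitions : shattering v_partition.
Proof.
apply/shatteringP => // S Sseg.
have [S1 [S2 [S1seg S2seg S1S S2S dis]]] := star_segment_split Sseg.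
have [||||P [Ppart AP _]] := @exists_v_partition star_segment [set S1; S2].
- by [].
- by move=> T Tseg; exists T.
- by move=> T [->|->].
- split=> [T [->|->] //|T U [->|->] [->|->] // _].
  exact: star_disjointC.
exists P => //; move=> [T PT ST].
have S1T : S1 = T.
  by apply: (star_disjoint_family_eq Ppart.1 _ PT S1seg) => [|//|X /S1S/ST //];
    apply: AP; left.
have S2T : S2 = T.
  by apply: (star_disjoint_family_eq Ppart.1 _ PT S2seg) => [|//|X /S2S/ST //];
    apply: AP; right.
by apply: (star_disjoint_segmentF S1seg _ _ dis); rewrite // S1T -S2T.
Qed.

(* If the partitions had no common lower bound below [S], the isomorphism
   between the segments below [S] and all segments would turn them into a
   shattering matrix that is too small. *)
Lemma common_below_dense (K : Type) (D : set K) (P : K -> set (set (set nat))) :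
  (forall H, v_matrix H -> shattering H -> ~ (H #<= D)%card) ->
  (forall a, D a -> v_partition (P a)) ->
  forall S, star_segment S ->
  exists T, [/\ star_segment T, T `<=` S & forall a, D a -> below (P a) T].
Proof.
move=> small Ppart S Sseg; apply: contrapT => no.
have [f [fS fsurj fsub]] := star_segment_homogeneous Sseg.
pose P' a : set (set (set nat)) :=
  [set T | star_segment T /\ exists2 U, P a U & f T = U `&` S].
have P'part a : D a -> v_partition (P' a).
  move=> Da; have [[Pseg _] _] := Ppart a Da.
  apply: v_partition_predense.
    split=> [T [] //|T T' [Tseg [U PU fT]] [T'seg [U' PU' fT']] ne].
    apply: contrapT => /(not_star_disjoint Tseg T'seg) W; apply: ne.
    have [fWseg _] := fS _ W.
    have fWT : f (T `&` T') `<=` f T by apply/fsub => // X [].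
    have fWT' : f (T `&` T') `<=` f T' by apply/fsub => // X [].
    have UU' : U = U'.
      apply: (star_disjoint_family_eq (Ppart a Da).1 PU PU' fWseg) => X.
        by move=> /fWT; rewrite fT => -[].
      by move=> /fWT'; rewrite fT' => -[].
    by apply/seteqP; split; apply/fsub => //; rewrite fT fT' UU'.
  move=> W Wseg; have [fWseg fWS] := fS W Wseg.
  have [U PU UW] := v_partition_meets (Ppart a Da) fWseg.
  have [|T Tseg fT] := fsurj (U `&` S) _ (@subIsetr _ _ _).
    apply: not_star_disjoint => //; first exact: Pseg.
    by apply: (star_disjoint_segmentF UW) => // X [_ /fWS].
  have [V Vseg fV] := fsurj _ UW (subset_trans (@subIsetr _ _ _) fWS).
  exists T; first by split=> //; exists U.
  apply: (star_disjoint_segmentF Vseg); apply/fsub => //; rewrite fV ?fT //.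
  by move=> X [UX /fWS].
have P'mat : v_matrix (P' @` D) by move=> _ [a Da <-]; exact: P'part.
apply: (small _ P'mat _ (card_image_le _ _)).
(* A segment [T] below every [P' a] would have an image [f T] below every [P a], against [no]. *)
apply/shatteringP => // T Tseg; apply: contrapT => nT; apply: no.
have [fTseg fTS] := fS T Tseg; exists (f T); split=> // a Da.
have [U [Useg [V PV fU]] TU] : below (P' a) T.
  by apply: contrapT => nb; apply: nT; exists (P' a) => //; exists a.
exists V => // X; have : f T `<=` f U by apply/fsub.
by rewrite fU => sub /sub[].
Qed.

(** Enter the dense open sets one after another and take a lower bound of the resulting decreasing
    sequence. *)
Lemma countable_below (P : nat -> set (set (set nat))) (S : set (set nat)) :
  (forall n, v_partition (P n)) -> star_segment S ->
  exists2 T, star_segment T & forall n, below (P n) T.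
Proof.
move=> Ppart Sseg.
have [[n U]|f fP] := @choice (nat * set (set nat)) (set (set nat)) (fun x T =>
    star_segment x.2 -> [/\ star_segment T, T `<=` x.2 & below (P x.1) T]).
  have [Useg|nU] := pselect (star_segment U); last by exists U.
  by have [T] := below_dense (Ppart n) Useg; exists T.
pose s := fix s n := if n is m.+1 then f (m, s m) else S.
have sseg n : star_segment (s n).
  by elim: n => //= n /(fP (n, s n))[].
have [T Tseg Ts] : exists2 T, star_segment T & forall n, T `<=` s n.
  by apply: star_segment_sigma_closed => // n; have [] := fP (n, s n) (sseg n).
exists T => // n; have [_ _] := fP (n, s n) (sseg n).
exact: belowS (Ts n.+1).
Qed.

(* [nat -> bool] stands for the continuum. *)
Definition rich (P : set (set (set nat))) (S : set (set nat)) : Prop :=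
  star_segment S /\ exists m : (nat -> bool) -> set (set nat),
    injective m /\ forall x, P (m x) /\ star_segment (m x `&` S).

(** * Hitting all rich segments by a refinement *)

Lemma code_star_segments : exists d : (nat -> bool) -> set (set nat),
  forall S, star_segment S -> exists x, d x = S.
Proof.
(* Even places code the lower endpoint and odd places the upper one. *)
exists (fun x => star_interval [set n | x n.*2] [set n | x n.*2.+1]).
move=> _ [A [B [_ [_ ->]]]].
exists (fun n => if odd n then `[< B n./2 >] else `[< A n./2 >]).
congr star_interval; apply/seteqP; split=> n /=;
  by rewrite ?odd_double ?uphalf_double ?doubleK //= => /asboolP.
Qed.

(** Run through the codes [x] of segments along an initial well-order of the continuum. Fewer than
    continuum many members of [R] are used before [x], so a rich [d x] meets a fresh one, [f x]. The
    intersections of [f x] with [d x] are disjoint and extend to a v-partition refining [R]. *)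
Lemma exists_hitting_refinement (R : set (set (set nat))) : v_partition R ->
  exists P, [/\ v_partition P, refines P R &
    forall S, rich R S -> exists2 T, P T & T `<=` S].
Proof.
move=> Rpart; have [[Rseg Rdis] _] := Rpart.
have [d dP] := code_star_segments.
have [le [wo init]] := exists_initial_well_order (nat -> bool).
have [|||f fP] := @wf_choice (nat -> bool) (set (set nat)) (strict le) (fun x g T =>
  rich R (d x) -> [/\ R T, star_segment (T `&` d x) &
    forall y, strict le y x -> rich R (d y) -> g y <> T]) set0.
- exact: wo_strict_wf.
- move=> x g g' T gg' gT Rx; have [RT Tx ne] := gT Rx; split=> // y yx Ry.
  by rewrite -gg' //; exact: ne.
- move=> x g _; have [Rx|nRx] := pselect (rich R (d x)); last by exists set0.
  have [_ [m [mI mR]]] := Rx.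
  (* If every [m z] had been used before [x], sending [z] to a stage using it would inject the
     continuum into a proper initial segment. *)
  apply: contrapT => no; apply: (init x).
  have [z|b bP] := @choice (nat -> bool) (nat -> bool)
      (fun z y => strict le y x /\ g y = m z).
    apply: contrapT => nz; apply: no; exists (m z) => _; have [Rm mx] := mR z.
    by split=> // y yx _ gy; apply: nz; exists y.
  apply: (@card_le_fun _ _ _ _ b) => [z _|z z' _ _ bz]; first by have [] := bP z.
  by apply: mI; have [_ <-] := bP z; have [_ <-] := bP z'; rewrite bz.
pose A : set (set (set nat)) := [set T | exists x, rich R (d x) /\ T = f x `&` d x].
pose D : set (set (set nat)) := [set T | star_segment T /\ below R T].
have [||||P [Ppart AP PD]] := @exists_v_partition D A.
- by move=> T [].
- move=> S /(below_dense Rpart)[T [Tseg TS RT]]; exists T => //.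
- move=> _ [x [Rx ->]]; have [Rfx fx _] := fP x Rx; split=> //.
  by exists (f x).
- split=> [_ [x [Rx ->]]|_ _ [x [Rx ->]] [y [Ry ->]] ne].
    by have [] := fP x Rx.
  have [Rfx fx nex] := fP x Rx; have [Rfy fy ney] := fP y Ry.
  apply: (@star_disjointS (f x) _ (f y)); [by move=> ? []|by move=> ? []|].
  apply: Rdis => // fxy; have xy : x <> y by move=> xy; apply: ne; rewrite xy.
  have [xley|ylex] := wo_total wo x y; first by case: (ney x).
  by case: (nex y) => //; split=> // /esym.
exists P; split=> // [T /PD[_ [U RU TU]]|S RS]; first by exists U.
have [x xS] := dP S RS.1; exists (f x `&` S); last by move=> ? [].
by apply: AP; exists x; rewrite xS.
Qed.

(** * Shattering matrices that refine along a well-order *)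

Section RefiningMatrix.
Context {K : Type} {le : rel K} (wo : wochoice.well_order le).
Context {P : K -> set (set (set nat))} (Ppart : forall a, v_partition (P a)).
Context (Pref : forall a b, strict le a b -> refines (P b) (P a)).
Context (Pshat : forall S, star_segment S -> exists a, ~ below (P a) S).

(** If the levels [b n] were unbounded, a segment below all of them would be below every level,
    against shattering. *)
Lemma countable_levels_bounded (S : set (set nat)) (b : nat -> K) :
  star_segment S -> exists a, forall n, strict le (b n) a.
Proof.
move=> Sseg; apply: contrapT => no.
have [T Tseg Tbelow] := countable_below (fun n => Ppart (b n)) Sseg.
have [a na] := Pshat Tseg; apply: na.
have [n nbn] : exists n, ~ strict le (b n) a.
  by apply: contrapT => nn; apply: no; exists a => n; apply: contrapT => ?;
    apply: nn; exists n.
have [->|/Pref ref] := wo_strict_total wo nbn; first exact: Tbelow.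
exact: below_refines ref (Tbelow n).
Qed.

(* A binary tree of segments below [S], split at each node by some level of the
   matrix; distinct branches are separated at a level bounded by [a]. *)
Lemma eventually_rich (S : set (set nat)) : star_segment S ->
  exists a, forall R, v_partition R -> (forall b, strict le b a -> refines R (P b)) ->
  rich R S.
Proof.
move=> Sseg; have [a0 _] := Pshat Sseg.
(* [r T] consists of a level and, for each bit, a piece of [T] with the member of that level
   containing it; the two members differ. *)
have [T|r rP] := @choice (set (set nat)) (K * (bool -> set (set nat) * set (set nat)))
  (fun T r => star_segment T ->
    (forall i, [/\ star_segment (r.2 i).1, (r.2 i).1 `<=` T, P r.1 (r.2 i).2 &
      (r.2 i).1 `<=` (r.2 i).2]) /\
    (r.2 true).2 <> (r.2 false).2).
  have [Tseg|nT] := pselect (star_segment T); last by exists (a0, fun=> (set0, set0)).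
  have [a /(not_below_split (Ppart a) Tseg)[U [V [PU PV UV UT VT]]]] := Pshat Tseg.
  by exists (a, fun i : bool => if i then (U `&` T, U) else (V `&` T, V)) => _;
    split=> // -[]; split=> // X [].
pose t (s : seq bool) := foldl (fun T i => ((r T).2 i).1) S s.
have tS s i : t (rcons s i) = ((r (t s)).2 i).1 by rewrite /t foldl_rcons.
have tseg s : star_segment (t s).
  elim/last_ind: s => [//|s i /rP[+ _]]; rewrite tS => /(_ i)[] //.
(* The nodes are finite sequences, enumerated by [unpickle]; numbers that code no node stand for the
   root. *)
have [a aP] := @countable_levels_bounded S
  (fun n => (r (t (odflt [::] (choice.unpickle n)))).1) Sseg.
have {}aP s : strict le (r (t s)).1 a.
  by have := aP (choice.pickle s); rewrite choice.pickleK.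
exists a => R Rpart Rref; split=> //.
have [x|B BP] := @choice (nat -> bool) (set (set nat)) (fun x T =>
    star_segment T /\ forall n, T `<=` t (mkseq x n)).
  have [||T Tseg Tt] := @star_segment_sigma_closed (fun n => t (mkseq x n)).
  - by move=> n; exact: tseg.
  - by move=> n; rewrite mkseqS tS; have [/(_ (x n))[]] := rP _ (tseg (mkseq x n)).
  by exists T.
have [x|m mP] := @choice (nat -> bool) (set (set nat))
    (fun x M => R M /\ star_segment (M `&` B x)).
  by have [M RM MB] := v_partition_meets Rpart (BP x).1; exists M.
exists m; split=> [x y mxy|x]; last first.
  have [Rm mB] := mP x; split=> //; apply: not_star_disjoint => //.
    exact: Rpart.1.1.
  by apply: (star_disjoint_segmentF mB) => // X [_ /((BP x).2 0)].
apply: funext => n0; apply: contrapT => /eqP ne.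
(* At the first place [n] where the branches part, the common value of [m x] and [m y] lies in one
   member [U] of the level splitting the node [s], yet the two branches continue into different
   members. *)
have [n {}ne nmin] := @ex_minnP (fun n => x n != y n) (ex_intro _ n0 ne).
have pre : mkseq x n = mkseq y n.
  apply/eq_in_map => k; rewrite mem_iota add0n => /= kn; apply/eqP.
  by apply: contraLR kn => /nmin; rewrite -leqNgt.
set s := mkseq x n in pre.
have [Rm _] := mP x.
have [U [PU mU]] := Rref _ (aP s) _ Rm.
have Ueq z : mkseq z n = s -> m z = m x -> U = ((r (t s)).2 (z n)).2.
  move=> zs zx; have [/(_ (z n))[_ _ PV tV] _] := rP _ (tseg s).
  apply: (star_disjoint_family_eq (Ppart (r (t s)).1).1 PU PV (mP z).2) => X [].
    by rewrite zx => /mU.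
  by move=> _ /((BP z).2 n.+1); rewrite mkseqS zs tS => /tV.
have [_] := rP _ (tseg s).
have := Ueq x erefl erefl; have := Ueq y (esym pre) (esym mxy).
by move: ne; case: (x n) (y n) => -[] // _ <- <-.
Qed.

End RefiningMatrix.

(** * Construction of the matrix *)

Lemma exists_is_kappa_v : exists H (K := set_type H) (le : rel K),
  v_matrix H /\ shattering H /\ is_kappa_v le.
Proof.
have [|H [[Hmat Hshat] Hmin]] := @exists_least_card (set (set (set nat)))
    (fun H => v_matrix H /\ shattering H).
  by exists v_partition; split; [|exact: shattering_v_partitions].
(* The members of [H] themselves index the levels, so that level [a] can be made to refine [a]. *)
have [le [wo init]] := exists_initial_well_order (set_type H).
exists H, le; split=> //; split=> //; split=> //; split=> //; split.
  by exists H; split=> //; split=> //; exact: card_setT.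
move=> H' mat shat; apply: card_le_trans (Hmin H' (conj mat shat)).
by have /card_eqPle[] := card_setT H.
Qed.

Theorem theorem11 :
  exists (K : Type) (le : rel K), is_kappa_v le /\
  exists P : K -> set (set (set nat)),
    v_matrix (range P) /\
    (forall a b : K, strict le a b -> refines (P b) (P a)) /\
    (forall S : set (set nat), star_segment S ->
       exists T : set (set nat), (\bigcup_(a in [set: K]) P a) T /\ T `<=` S).
Proof.
have [H [le [Hmat [Hshat kappa]]]] := exists_is_kappa_v.
exists (set_type H), le; split=> //; have [wo [init [_ Hmin]]] := kappa.
(* Level [t] refines the member [a] of [H], which transfers shattering, and a common refinement [R]
   of the earlier levels. [R] is recorded since richness is tested on [R] and the hits occur in
   [t]. *)
pose Q a (P : set_type H -> set (set (set nat))) t :=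
  v_partition t /\ refines t (set_val a) /\
  exists R, [/\ v_partition R, forall b, strict le b a -> refines R (P b), refines t R &
    forall S, rich R S -> exists2 T, t T & T `<=` S].
have [|||P PQ] := @wf_choice (set_type H) (set (set (set nat))) (strict le) Q set0.
- exact: wo_strict_wf.
- move=> a P P' t PP' [tpart [ta [R [Rpart Rref tR hit]]]]; split=> //; split=> //.
  by exists R; split=> // b ba; rewrite -PP' //; exact: Rref.
- move=> a P PQ.
  have Apart : v_partition (set_val a) by apply: Hmat; exact: set_valP.
  pose D : set (set (set nat)) := [set T | star_segment T /\ below (set_val a) T /\
    forall b, strict le b a -> below (P b) T].
  have [||||R [Rpart _ RD]] := @exists_v_partition D set0.
  - by move=> T [].
  - move=> S Sseg.
    have [||T [Tseg TS PT]] := @common_below_dense _ [set b | strict le b a] P _ _ S Sseg.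
    (* Fewer than kappa(v) levels precede [a], as the well-order is initial. *)
    + move=> H' mat shat small; apply: (init a).
      exact: card_le_trans (Hmin H' mat shat) small.
    + by move=> b /PQ[].
    have [U [Useg UT aU]] := below_dense Apart Tseg.
    exists U; last exact: subset_trans TS.
    by split=> //; split=> // b /PT; exact: belowS.
  - by [].
  - by split=> [?|? ?] [].
  have [t [tpart tR hit]] := exists_hitting_refinement Rpart.
  exists t; split=> //; split.
    by apply: refines_trans tR _ => S /RD[_ [[T ? ?] _]]; exists T.
  exists R; split=> // b ba S /RD[_ [_ /(_ b ba)[T ? ?]]]; by exists T.
have Ppart a : v_partition (P a) by have [] := PQ a.
have Pref a b : strict le a b -> refines (P b) (P a).
  by move=> ab; have [_ [_ [R [_ /(_ a ab) Ra tR _]]]] := PQ b; exact: refines_trans Ra.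
exists P; split; first by move=> _ [a _ <-].
split=> // S Sseg.
(* Since level [a] refines the member [a] of [H], a segment below all levels would contradict the
   shattering of [H]. *)
have Pshat T : star_segment T -> exists a, ~ below (P a) T.
  move=> /((shatteringP Hmat).1 Hshat)[h Hh nh].
  pose a : set_type H := SigSub (mem_set Hh); exists a.
  by apply: contra_not nh; apply: below_refines; have [_ [ref _]] := PQ a.
have [a aP] := eventually_rich wo Ppart Pref Pshat Sseg.
have [_ [_ [R [Rpart Rref _ hit]]]] := PQ a.
have [T PT TS] := hit S (aP R Rpart Rref).
by exists T; split=> //; exists a.
Qed.
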